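(* Suppose $T=(F,E,p,q)$ is a left-resolving textile system where $F,E$ are finite graphs. Then $(\mathsf{X}_T^+,\sigma)$ forms a rank-$2$ Deaconu--Renault system.
   Context: A directed graph is written $E=(E^0,E^1,r_E,s_E)$ (vertices, edges, range, source). A graph homomorphism $f:F\to E$ is a pair $(f^0,f^1)$, $f^i:F^i\to E^i$, commuting with ranges and sources (superscripts are often dropped). A textile system is $T=(F,E,p,q)$ with $F,E$ directed graphs and $p,q:F\to E$ graph homomorphisms such that $f\mapsto (s_F(f),r_F(f),p(f),q(f))$ is injective on $F^1$. A homomorphism $p:F\to E$ has unique $r$-path lifting (resp. unique $s$-path lifting) if whenever $v\in F^0$, $e\in E^1$ and $p^0(v)=r_E(e)$ (resp. $p^0(v)=s_E(e)$), there is a unique $f\in F^1$ with $r_F(f)=v$ (resp. $s_F(f)=v$) and $p^1(f)=e$. $T$ is left-resolving if $p$ has unique $r$-path lifting and $q$ has unique $s$-path lifting. $\mathbb{N}$ includes $0$. $\mathsf{X}_T^+:=\{x:\mathbb{N}^2\to F^1 \mid r_F(x_{\mathbf n})=s_F(x_{\mathbf n+\mathbf e_1}),\ q(x_{\mathbf n})=p(x_{\mathbf n+\mathbf e_2})\ \forall \mathbf n\in\mathbb{N}^2\}$, with the subspace topology from the product $(F^1)^{\mathbb{N}^2}$ of discrete spaces. The shift action $\sigma$ of $\mathbb{N}^2$ is $(\sigma_{\mathbf n}(x))_{\mathbf m}=x_{\mathbf m+\mathbf n}$. A rank-$k$ Deaconu--Renault system $(X,\sigma)$ is a locally compact Hausdorff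 space $X$ together with an action $\mathbf n\mapsto\sigma_{\mathbf n}$ of the monoid $\mathbb{N}^k$ on $X$ such that every $\sigma_{\mathbf n}:X\to X$ is a local homeomorphism. *)

(* Defs.v *)
From HB Require Import structures.
From mathcomp Require Import all_boot all_order all_algebra.
From mathcomp Require Import all_classical topology.

Set Implicit Arguments.
Unset Strict Implicit.
Unset Printing Implicit Defensive.

Import GRing.Theory.

Local Open Scope classical_set_scope.
Local Open Scope ring_scope.

(* A choice type of edges is needed to put a topology on it, and is classically
   no restriction. *)
Record digraph := Digraph {
  vertex : Type;
  edge : choiceType;
  rg : edge -> vertex;
  src : edge -> vertex
}.

Arguments rg {d}.
Arguments src {d}.

Definition finite_digraph (G : digraph) : Prop :=
  finite_set [set: vertex G] /\ finite_set [set: edge G].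

Record graph_hom (F E : digraph) := GraphHom {
  hom0 : vertex F -> vertex E;
  hom1 : edge F -> edge E;
  hom_rg : forall f : edge F, hom0 (rg f) = rg (hom1 f);
  hom_src : forall f : edge F, hom0 (src f) = src (hom1 f)
}.

Record textile_system (F E : digraph) := TextileSystem {
  tp : graph_hom F E;
  tq : graph_hom F E;
  textile_inj :
    injective (fun f : edge F => (src f, rg f, hom1 tp f, hom1 tq f))
}.

Definition unique_r_path_lifting (F E : digraph) (p : graph_hom F E) : Prop :=
  forall (v : vertex F) (e : edge E), hom0 p v = rg e ->
    exists! f : edge F, rg f = v /\ hom1 p f = e.

Definition unique_s_path_lifting (F E : digraph) (p : graph_hom F E) : Prop :=
  forall (v : vertex F) (e : edge E), hom0 p v = src e ->
    exists! f : edge F, src f = v /\ hom1 p f = e.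

Definition left_resolving (F E : digraph) (T : textile_system F E) : Prop :=
  unique_r_path_lifting (tp T) /\ unique_s_path_lifting (tq T).

(* The monoid N^k is 'rV[nat]_k. The index of unitv starts at 0, so that
   e_1 = unitv 0 and e_2 = unitv 1 in N^2. *)
Definition unitv (k : nat) (i : 'I_k) : 'rV[nat]_k := delta_mx 0 i.

Definition edge_configs (F : digraph) : topologicalType :=
  prod_topology (fun _ : 'rV[nat]_2 => discrete_topology (edge F)).

Definition textile_configs (F E : digraph) (T : textile_system F E) :
    set (edge_configs F) :=
  [set x | forall n : 'rV[nat]_2,
     rg (x n : edge F) = src (x (n + unitv 0) : edge F) /\
     hom1 (tq T) (x n) = hom1 (tp T) (x (n + unitv 1))].

(* The topology of set_type is the subspace one. *)
Definition textile_space (F E : digraph) (T : textile_system F E) :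
  topologicalType := set_type (textile_configs T).

Lemma shift_textile_configs (F E : digraph) (T : textile_system F E)
    (n : 'rV[nat]_2) (x : edge_configs F) :
  textile_configs T x -> textile_configs T (fun m => x (m + n)).
Proof. by move=> Tx m; have := Tx (m + n); rewrite ![m + n + _]addrAC. Qed.

Definition shift (F E : digraph) (T : textile_system F E) (n : 'rV[nat]_2)
    (x : textile_space T) : textile_space T :=
  exist _ (fun m => set_val x (m + n))
    (mem_set (shift_textile_configs n (set_valP x))).

Definition homeomorphism_between (X Y : topologicalType)
    (A : set X) (B : set Y) (f : X -> Y) : Prop :=
  exists g : Y -> X,
    [/\ set_fun A B f, set_fun B A g,
        {in A, cancel f g}, {in B, cancel g f} &
        {within A, continuous f} /\ {within B, continuous g}].

Definition local_homeomorphism (X Y : topologicalType) (f : X -> Y) : Prop :=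
  forall x : X, exists U : set X,
    [/\ open U, U x, open (f @` U) & homeomorphism_between U (f @` U) f].

Definition monoid_action (k : nat) (X : Type) (s : 'rV[nat]_k -> X -> X) :
    Prop :=
  s 0 = id /\ forall m n : 'rV[nat]_k, s (m + n) = s m \o s n.

Definition deaconu_renault (k : nat) (X : topologicalType)
    (s : 'rV[nat]_k -> X -> X) : Prop :=
  [/\ locally_compact [set: X], hausdorff_space X, monoid_action s &
      forall n : 'rV[nat]_k, local_homeomorphism (s n)].

(* Main.v *)
(* X_T^+ is a closed subspace of a product of finite discrete spaces, hence
   compact Hausdorff. Left-resolving says that an edge f to the left of (resp.
   below) a and an edge b above (resp. to the right of) a complete to a unit
   square of a configuration in exactly one way. So a configuration y has
   exactly one preimage under a unit shift for each admissible value of its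
   0-th entry: unit shifts are injective on the clopen sets {x | x_0 = f} and
   have clopen images there, so by compactness they are open, and general
   shifts are composites of unit shifts. *)
From mathcomp Require Import all_boot all_algebra.
From mathcomp Require Import all_classical topology.
Require Import Defs.

Set Implicit Arguments.
Unset Strict Implicit.
Unset Printing Implicit Defensive.

Import GRing.Theory.

Local Open Scope classical_set_scope.
Local Open Scope ring_scope.

(** * Continuous, open, locally injective maps *)

Definition open_map (X Y : topologicalType) (f : X -> Y) : Prop :=
  forall A : set X, open A -> open (f @` A).

Definition locally_injective (X : topologicalType) (Y : Type) (f : X -> Y) :
    Prop :=
  forall x : X, exists U : set X, [/\ open U, U x & {in U &, injective f}].

(* Equivalent to [local_homeomorphism], in a form that is
   visibly stable under composition. *)
Definition etale (X Y : topologicalType) (f : X -> Y) : Prop :=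
  [/\ continuous f, open_map f & locally_injective f].

Lemma etale_id (X : topologicalType) : etale (@id X).
Proof.
split; first by move=> x; exact: cvg_id.
- by move=> A; rewrite image_id.
- by move=> x; exists setT; split=> //; exact: openT.
Qed.

Lemma etale_comp (X Y Z : topologicalType) (f : X -> Y) (g : Y -> Z) :
  etale f -> etale g -> etale (g \o f).
Proof.
move=> [cf of_ lf] [cg og lg]; split.
- by move=> x; apply: continuous_comp; [exact: cf | exact: cg].
- by move=> A oA; rewrite -image_comp; apply: og; apply: of_.
- move=> x; have [U [oU Ux injU]] := lf x; have [V [oV Vfx injV]] := lg (f x).
  exists (U `&` f @^-1` V); split=> //.
    by apply: openI => //; apply: open_comp => // y _; exact: cf.
  move=> y z /set_mem[Uy Vy] /set_mem[Uz Vz] gfyz.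
  by apply: injU; rewrite ?inE //; apply: injV; rewrite ?inE.
Qed.

Lemma etale_local_homeomorphism (X Y : topologicalType) (f : X -> Y) :
  etale f -> local_homeomorphism f.
Proof.
move=> [cf of_ lf] x; have [U [oU Ux injU]] := lf x.
exists U; split=> //; first exact: of_.
(* The inverse branch by choice; the default [x] is returned only off the image of [U]. *)
pose g y := xget x [set z | U z /\ f z = y].
have fK z : U z -> g (f z) = z.
  move=> Uz; rewrite /g; case: xgetP => [w _ [Uw fwz]|/(_ z)[]//].
  by apply: injU; rewrite ?inE.
exists g; split.
- by move=> z Uz; exists z.
- by move=> _ [z Uz <-]; rewrite fK.
- by move=> z /set_mem /fK.
- by move=> _ /set_mem[z Uz <-]; rewrite fK.
- split; first exact: continuous_subspaceT.
  (* The image of [U] is open, so continuity of [g] can be tested in [Y], where it follows from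
     openness of [f]. *)
  rewrite continuous_open_subspace; last exact: of_.
  move=> _ /set_mem[z Uz <-]; rewrite /continuous_at fK // => W.
  rewrite nbhsE => -[W' [oW' W'z] W'W].
  apply: (@filterS _ _ _ (f @` (U `&` W'))).
    by move=> _ [w [Uw W'w] <-] /=; rewrite fK //; exact: W'W.
  apply: open_nbhs_nbhs; split; last by exists z.
  by apply: of_; exact: openI.
Qed.

(* For [A] open, [f @` (A `&` U) = f @` U `\` f @` (U `\` A)] by injectivity on
   [U], and [f @` (U `\` A)] is compact, hence closed. *)
Lemma compact_etale (X Y : topologicalType) (f : X -> Y) :
  compact [set: X] -> hausdorff_space Y -> continuous f ->
  (forall x : X, exists U : set X,
     [/\ clopen U, U x, {in U &, injective f} & open (f @` U)]) ->
  etale f.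
Proof.
move=> cX hY cf lf; split=> //; last first.
  by move=> x; have [U [[oU _] Ux injU _]] := lf x; exists U.
move=> A oA; rewrite openE => _ [x Ax <-].
have [U [[oU cU] Ux injU ofU]] := lf x.
have clf : closed (f @` (U `\` A)).
  apply: compact_closed => //; apply: continuous_compact.
    exact: continuous_subspaceT.
  apply: subclosed_compact cX _ => //.
  by rewrite setDE; apply: closedI => //; exact: open_closedC.
apply: (@filterS _ _ _ (f @` U `\` f @` (U `\` A))).
  move=> _ [[z Uz <-] nz]; exists z => //.
  by apply: contrapT => nAz; apply: nz; exists z.
apply: open_nbhs_nbhs; split.
  by rewrite setDE; apply: openI => //; exact: closed_openC.
split; first by exists x.
move=> [z [Uz nAz] fzx]; apply: nAz.
by rewrite (injU z x _ _ fzx) ?inE.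
Qed.

(** * Subspaces and products *)

(** A filter on the subtype is pushed forward to [X]; its cluster point in [A] lifts, since
    neighbourhoods in the subtype contain traces of open sets of [X]. *)
Lemma compact_set_type (X : topologicalType) (A : set X) :
  compact A -> compact [set: set_type A].
Proof.
move=> cA G PG _.
have [|p [Ap clp]] := cA (set_val @ G) _.
  by apply: (@filterS _ G _ setT) => [x _|]; [exact: set_valP | exact: filterT].
exists (exist _ p (mem_set Ap)); split=> //.
move=> B C GB [_ [[C' oC' <-] C'p] C'C].
have [||q [[x Bx <-] C'q]] := clp (set_val @` B) C'.
- by rewrite /= nbhs_simpl; apply: filterS GB => x Bx; exists x.
- by apply: open_nbhs_nbhs; split.
- by exists x; split=> //; exact: C'C.
Qed.

Lemma hausdorff_set_type (X : topologicalType) (A : set X) :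
  hausdorff_space X -> hausdorff_space (set_type A).
Proof.
move=> hX p q clpq; apply: val_inj; apply: hX => B C nB nC.
have cval := @initial_continuous (set_type A) X set_val.
have [x [Bx Cx]] := clpq _ _ (cval p B nB) (cval q C nC).
by exists (set_val x).
Qed.

Lemma continuous_prod_topology (X : topologicalType) (I : Type)
    (K : I -> topologicalType) (f : X -> prod_topology K) :
  (forall i, continuous (fun x => f x i)) -> continuous f.
Proof.
move=> cf x; apply/cvg_sup => i U [_ [[B oB <-] Bfx] BU].
by apply: filterS BU _; apply: (cf i x); exact: open_nbhs_nbhs.
Qed.

(** * Coordinates and unit vectors *)

Lemma unitvE (k : nat) (i l : 'I_k) : unitv i 0 l = (l == i) :> nat.
Proof. by rewrite mxE eqxx; case: eqP. Qed.

Lemma add_unitvE (k : nat) (m : 'rV[nat]_k) (i l : 'I_k) :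
  (m + unitv i) 0 l = (m 0%R l + (l == i))%N.
Proof. by rewrite mxE unitvE. Qed.

Lemma unitv_mulrnE (k c : nat) (i l : 'I_k) :
  (unitv i *+ c) 0 l = (c * (l == i))%N.
Proof.
elim: c => [|c IH]; first by rewrite mulr0n mxE.
by rewrite mulrSr add_unitvE IH mulSnr.
Qed.

Lemma ord2_neqE (i j l : 'I_2) : i != j -> (l == j) = (l != i).
Proof. by case: i j l => [[|[|?]] ?] [[|[|?]] ?] [[|[|?]] ?]. Qed.

Lemma ord2_ex_neq (i : 'I_2) : exists j : 'I_2, i != j.
Proof. by exists (rev_ord i); case: i => [[|[|?]] ?]. Qed.

(** Separates the entries that survive the unit shift in direction [i] from those it deletes, which
    lie on the [j]-axis. *)
Lemma rV2_cases (i j : 'I_2) (m : 'rV[nat]_2) : i != j ->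
  (exists n, m = n + unitv i) \/ (exists k, m = unitv j *+ k).
Proof.
move=> ij; case E : (m 0 i) => [|c].
  right; exists (m 0 j); apply/rowP => l; rewrite unitv_mulrnE.
  rewrite (ord2_neqE _ ij); case: eqP => [->|/eqP li] /=.
    by rewrite E muln0.
  by rewrite muln1; congr (m 0 _); apply/eqP; rewrite (ord2_neqE _ ij).
left; exists (\row_l (m 0%R l - (l == i))%N); apply/rowP => l.
by rewrite add_unitvE mxE; case: eqP => [->|_]; rewrite ?E ?subnK ?subn0 ?addn0.
Qed.

(** * Square filling, for both directions at once *)

Section square_filling.
Variables (A : choiceType) (R : 'I_2 -> A -> A -> Prop).

(** In a unit square, [f] sits at the origin, [a] at e_i, [b] at e_i + e_j, and [g] is the missing
    corner at e_j. *)
Hypothesis R_square : forall (i j : 'I_2) (f a b : A), i != j ->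
  R i f a -> R j a b -> exists! g, R j f g /\ R i g b.

Definition R_config (x : 'rV[nat]_2 -> A) : Prop :=
  forall (i : 'I_2) (n : 'rV[nat]_2), R i (x n) (x (n + unitv i)).

(** Only the [j]-axis is in question. Climbing it from the origin, each next entry is the unique
    missing corner of a square whose other three corners agree. *)
Lemma R_config_inj (i : 'I_2) (x x' : 'rV[nat]_2 -> A) :
  R_config x -> R_config x' -> x 0 = x' 0 ->
  (forall n, x (n + unitv i) = x' (n + unitv i)) -> x = x'.
Proof.
move=> Rx Rx' x0 xi; have [j ij] := ord2_ex_neq i.
apply/funext => m; case: (rV2_cases m ij) => [[n ->]//|[k ->]].
elim: k => [|k IH]; first by rewrite mulr0n.
have [g [_ gP]] := R_square ij (Rx i (unitv j *+ k)) (Rx j _).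
rewrite mulrSr -(gP (x _)); last by rewrite addrAC; split; exact: Rx.
apply: gP; rewrite IH; split; first exact: Rx'.
by rewrite addrAC xi; exact: Rx'.
Qed.

Lemma R_config_extend (i : 'I_2) (f : A) (y : 'rV[nat]_2 -> A) :
  R_config y -> R i f (y 0) ->
  exists x, [/\ R_config x, x 0 = f & forall n, x (n + unitv i) = y n].
Proof.
move=> Ry Rf; have [j ij] := ord2_ex_neq i.
pose next k g := xget f [set h | R j g h /\ R i h (y (unitv j *+ k.+1))].
pose c := fix c k := if k is k'.+1 then next k' (c k') else f.
have nextP k g : R i g (y (unitv j *+ k)) ->
    R j g (next k g) /\ R i (next k g) (y (unitv j *+ k.+1)).
  move=> Rg; rewrite /next; case: xgetP => [h _ //|no_h].
  have := Ry j (unitv j *+ k); rewrite -mulrSr => Ryj.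
  by have [h [/no_h]] := R_square ij Rg Ryj.
have cR k : R i (c k) (y (unitv j *+ k)).
  elim: k => [|k /nextP[]//]; by rewrite mulr0n.
have cS k : R j (c k) (c k.+1) by have [] := nextP k (c k) (cR k).
(* Off the new axis the [i]-th coordinate is positive, so the truncated subtraction really undoes a
   unit step. *)
pose x (m : 'rV[nat]_2) :=
  if m 0 i == 0%N then c (m 0 j) else y (\row_l (m 0%R l - (l == i))%N).
have xi n : x (n + unitv i) = y n.
  rewrite /x add_unitvE eqxx addn1 /=; congr y; apply/rowP => l.
  by rewrite mxE add_unitvE addnK.
have xj k : x (unitv j *+ k) = c k.
  by rewrite /x !unitv_mulrnE eqxx (negPf ij) muln0 eqxx muln1.
exists x; split=> //; last by rewrite -(mulr0n (unitv j)) xj.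
move=> l n; have [->|li] := eqVneq l i.
  by rewrite xi; case: (rV2_cases n ij) => -[k ->]; rewrite ?xi ?xj.
have -> : l = j by apply/eqP; rewrite (ord2_neqE _ ij).
case: (rV2_cases n ij) => -[k ->]; last by rewrite -mulrSr !xj.
by rewrite addrAC !xi.
Qed.

End square_filling.

(** * The textile space and its shifts *)

Section textile.
Variables (F E : digraph) (T : textile_system F E).

Definition edge_adj (i : 'I_2) (f g : edge F) : Prop :=
  if i == 0 then rg f = src g else hom1 (tq T) f = hom1 (tp T) g.

Lemma textile_configsE (x : edge_configs F) :
  textile_configs T x <-> R_config edge_adj x.
Proof.
split=> Rx; last by move=> n; split; [exact: (Rx 0 n) | exact: (Rx 1 n)].
move=> i n; have [x0 x1] := Rx n; rewrite /edge_adj.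
have [->//|i0] := eqVneq i 0; suff -> : i = 1 by [].
by apply/eqP; rewrite (@ord2_neqE 0).
Qed.

(** For [i = 0] the corner [g] must have range [src b] and p-image equal to the q-image of [f]: an
    r-lift along p. For [i = 1] it must have source [rg f] and q-image equal to the p-image of [b]:
    an s-lift along q. *)
Lemma left_resolving_square : left_resolving T ->
  forall (i j : 'I_2) (f a b : edge F), i != j ->
  edge_adj i f a -> edge_adj j a b ->
  exists! g, edge_adj j f g /\ edge_adj i g b.
Proof.
move=> [liftp liftq] i j f a b ij; rewrite /edge_adj.
have -> : (j == 0) = (i != 0) by rewrite eq_sym (ord2_neqE _ ij) eq_sym.
have [_ /= fa ab|_ /= fa ab] := eqVneq i 0.
  have [|g [[gb gf] g_uniq]] := liftp (src b) (hom1 (tq T) f).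
    by rewrite hom_src -ab -hom_src -fa hom_rg.
  by exists g; split=> [//|h [hf hb]]; apply: g_uniq.
have [|g [[gf gb] g_uniq]] := liftq (rg f) (hom1 (tp T) b).
  by rewrite hom_rg fa -hom_rg ab hom_src.
by exists g; split=> [//|h [hf hb]]; apply: g_uniq.
Qed.

Definition eval_edge (n : 'rV[nat]_2) (x : textile_space T) :
  discrete_topology (edge F) := set_val x n.

Lemma eval_edge_continuous n : continuous (eval_edge n).
Proof.
move=> x; apply: (@continuous_comp _ (edge_configs F) _ set_val (fun y => y n)).
  exact: initial_continuous.
exact: proj_continuous.
Qed.

Lemma clopen_eval_edge n (A : set (discrete_topology (edge F))) :
  clopen (eval_edge n @^-1` A).
Proof.
apply: preimage_clopen; last exact: eval_edge_continuous.
by split; [exact: discrete_open | exact: discrete_closed].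
Qed.

Lemma shift_continuous n : continuous (shift (T := T) n).
Proof.
apply: continuous_comp_initial; apply: continuous_prod_topology => m x.
exact: (@eval_edge_continuous (m + n)).
Qed.

(** The entries at [m] and [n] are locally constant in [x], so the complement is open. *)
Lemma closed_edge_rel (Q : edge F -> edge F -> Prop) (m n : 'rV[nat]_2) :
  closed [set x : edge_configs F | Q (x m) (x n)].
Proof.
rewrite -openC openE => x /= nQ.
have nbhs_eval k : nbhs x [set y : edge_configs F | y k = x k].
  exact: (@proj_continuous _ _ k x _ (discrete_set1 _)).
by apply: filterS (filterI (nbhs_eval m) (nbhs_eval n)) => y /= [-> ->].
Qed.

Lemma textile_space_compact : finite_set [set: edge F] ->
  compact [set: textile_space T].
Proof.
move=> finF; apply: compact_set_type.
have cB := @tychonoff _ (fun _ : 'rV[nat]_2 => discrete_topology (edge F))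
  (fun=> setT) (fun=> @finite_compact (discrete_topology (edge F)) setT finF).
apply: (subclosed_compact _ cB) => //.
rewrite (_ : textile_configs T =
    \bigcap_(n in [set: 'rV[nat]_2]) \bigcap_(i in [set: 'I_2])
      [set x : edge_configs F | edge_adj i (x n) (x (n + unitv i))]).
  apply: closed_bigI => n _; apply: closed_bigI => i _.
  exact: closed_edge_rel.
apply/seteqP; split=> x.
  by move=> /textile_configsE Rx n _ i _; exact: Rx.
by move=> Rx; apply/textile_configsE => i n; exact: Rx.
Qed.

Lemma textile_space_hausdorff : hausdorff_space (textile_space T).
Proof.
apply: hausdorff_set_type; apply: hausdorff_product => _.
exact: discrete_hausdorff.
Qed.

Lemma shift0 : shift (T := T) 0 = id.
Proof.
by apply/funext => x; apply: val_inj; apply/funext => m /=; rewrite addr0.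
Qed.

Lemma shiftD m n : shift (T := T) (m + n) = shift m \o shift n.
Proof.
by apply/funext => x; apply: val_inj; apply/funext => k /=; rewrite addrA.
Qed.

Hypotheses (finF : finite_set [set: edge F]) (resT : left_resolving T).

Lemma shift_unitv_etale (i : 'I_2) : etale (shift (T := T) (unitv i)).
Proof.
apply: compact_etale.
- exact: textile_space_compact.
- exact: textile_space_hausdorff.
- exact: shift_continuous.
move=> x; have squareT := left_resolving_square resT.
have config y := (textile_configsE _).1 (set_valP (y : textile_space T)).
exists (eval_edge 0 @^-1` [set eval_edge 0 x]); split=> //.
- exact: clopen_eval_edge.
- move=> y z /set_mem y0 /set_mem z0 yz; apply: val_inj.
  apply: (R_config_inj squareT (i := i) (config y) (config z)).
    exact: etrans y0 (esym z0).
  by move=> n; exact: (congr1 (eval_edge n) yz).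
(* By the extension lemma, [z] lies in the image of the cylinder exactly when its own entry at 0 may
   follow that of [x] in direction [i]; this is a clopen condition. *)
rewrite (_ : _ @` _ = eval_edge 0 @^-1` [set g | edge_adj i (eval_edge 0 x) g]).
  by have [] := clopen_eval_edge 0 [set g | edge_adj i (eval_edge 0 x) g].
apply/seteqP; split=> [_ [y y0 <-]|z adj_z] /=.
  by rewrite -y0; exact: (config y i 0).
have [y [Ry y0 yz]] := R_config_extend squareT (config z) adj_z.
exists (exist _ y (mem_set ((textile_configsE y).2 Ry))) => //.
by apply: val_inj; apply/funext => n; exact: yz.
Qed.

Lemma shift_etale n : etale (shift (T := T) n).
Proof.
have etaleM i k : etale (shift (T := T) (unitv i *+ k)).
  elim: k => [|k IH]; first by rewrite mulr0n shift0; exact: etale_id.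
  by rewrite mulrS shiftD; apply: etale_comp => //; exact: shift_unitv_etale.
have -> : n = unitv 0 *+ n 0 0 + unitv 1 *+ n 0 1.
  apply/rowP => l; rewrite mxE !unitv_mulrnE.
  have [->|l0] := eqVneq l 0; first by rewrite muln1 muln0 [RHS]addn0.
  have /eqP-> : l == 1 by rewrite (@ord2_neqE 0).
  by rewrite muln1 muln0 [RHS]add0n.
by rewrite shiftD; apply: etale_comp.
Qed.

End textile.

Theorem proposition5p1 (F E : digraph) (T : textile_system F E)
  (hF : finite_digraph F) (hE : finite_digraph E) (hT : left_resolving T) :
  @deaconu_renault 2 (textile_space T) (@shift F E T).
Proof.
have cT := @textile_space_compact F E T hF.2.
split.
(* The whole space is a compact neighbourhood of each point. *)
- move=> x _; exists setT; first by apply: withinT.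
  by split; [exact: cT | exact: closedT].
- exact: textile_space_hausdorff.
- by split; [exact: shift0 | exact: shiftD].
- by move=> n; apply: etale_local_homeomorphism; exact: shift_etale hF.2 hT n.
Qed.
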